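(* Let $G$ be a finite simple graph and let $X$ be an independent set of $G$ with $\ker(G) \subseteq X$. If there is a matching from $N(X)$ into $X$, then $X$ is critical.
   Context: For $A \subseteq V(G)$, $N(A)$ is the set of vertices adjacent to some vertex of $A$; $d(A)=|A|-|N(A)|$; $d_c(G)=\max\{d(A): A \subseteq V(G)\}$; a set $A$ is critical if $d(A)=d_c(G)$; $\ker(G)$ is the intersection of all critical sets of $G$. For disjoint $A,B\subseteq V(G)$, a matching from $A$ into $B$ is a matching in which every edge joins a vertex of $A$ and a vertex of $B$ and every vertex of $A$ is matched. *)

(* Defs.v *)
From mathcomp Require Import all_boot all_order all_algebra.
Set Implicit Arguments.
Unset Strict Implicit.
Unset Printing Implicit Defensive.
Import Order.TTheory GRing.Theory Num.Theory.

Section Graph.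

(* A finite simple graph is a finite vertex type T with an adjacency relation
   e; symmetry and irreflexivity of e are assumed where they are needed. *)
Variables (T : finType) (e : rel T).

Definition edges : {set {set T}} :=
  [set E | [exists x, exists y, e x y && (E == [set x; y])]].

Definition nbhd (A : {set T}) : {set T} := [set y | [exists x in A, e x y]].

Definition independent (X : {set T}) : bool :=
  [forall x in X, forall y in X, ~~ e x y].

(* The difference may be negative, hence int rather than truncated nat
   subtraction. *)
Definition diff (A : {set T}) : int := (#|A|%:Z - #|nbhd A|%:Z)%R.

(* The seed diff set0 is one of the values over which the maximum ranges. *)
Definition crit_diff : int :=
  \big[Order.max/diff set0]_(A : {set T}) diff A.

Definition critical (A : {set T}) : bool := diff A == crit_diff.

Definition ker : {set T} := \bigcap_(A : {set T} | critical A) A.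

Definition matching (M : {set {set T}}) : bool :=
  (M \subset edges) && trivIset M.

Definition matching_from_into (A B : {set T}) (M : {set {set T}}) : bool :=
  [&& matching M,
      [forall E in M, exists x in A, exists y in B, E == [set x; y]]
    & A \subset cover M].

End Graph.

(* Main.v *)
Require Import Defs.
From mathcomp Require Import all_boot all_order all_algebra.
From mathcomp Require Import zify.

(** The difference function [d] is supermodular, so critical sets are closed
    under intersection and [ker] is itself critical.  Given a matching from
    [N(X)] into [X], a vertex of [N(X)] outside [N(ker)] cannot be matched into
    [ker]; hence [|N(X) - N(ker)| <= |X - ker|], that is, [d(ker) <= d(X)]. *)

Set Implicit Arguments.
Unset Strict Implicit.
Unset Printing Implicit Defensive.
Import Order.TTheory GRing.Theory Num.Theory.

Section CriticalSets.

Variables (T : finType) (e : rel T).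
Implicit Types (A B X K : {set T}) (M : {set {set T}}).

Lemma nbhdP A y : reflect (exists2 x, x \in A & e x y) (y \in nbhd e A).
Proof. by rewrite inE; apply: exists_inP. Qed.

Lemma nbhdS A B : A \subset B -> nbhd e A \subset nbhd e B.
Proof.
move=> /subsetP sAB; apply/subsetP => y /nbhdP[x /sAB xB exy].
by apply/nbhdP; exists x.
Qed.

Lemma nbhdU A B : nbhd e (A :|: B) = nbhd e A :|: nbhd e B.
Proof.
apply/eqP; rewrite eqEsubset subUset !nbhdS ?subsetUl ?subsetUr //= andbT.
apply/subsetP => y /nbhdP[x]; rewrite !in_setU => /orP[xA|xB] exy.
  by apply/orP; left; apply/nbhdP; exists x.
by apply/orP; right; apply/nbhdP; exists x.
Qed.

(** Cardinality is modular and [nbhd] commutes with unions, but the neighbourhood of an intersection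
    is only contained in the intersection of the neighbourhoods. *)
Lemma diff_supermodular A B :
  (diff e A + diff e B <= diff e (A :|: B) + diff e (A :&: B))%R.
Proof.
have capN : #|nbhd e (A :&: B)| <= #|nbhd e A :&: nbhd e B|.
  by rewrite subset_leq_card // subsetI !nbhdS ?subsetIl ?subsetIr.
have cardN := cardsUI (nbhd e A) (nbhd e B).
have cardAB := cardsUI A B.
rewrite /diff nbhdU; lia.
Qed.

Lemma diff_le_crit_diff A : (diff e A <= crit_diff e)%R.
Proof. exact: le_bigmax. Qed.

Lemma exists_critical : exists A, critical e A.
Proof.
suff [A defA] : exists A, diff e A = crit_diff e.
  by exists A; rewrite /critical defA.
(* Being some [diff e A] holds for the seed [diff e set0] and is preserved by binary maxima. *)
rewrite /crit_diff; elim/big_ind: _ => [|u v [A <-] [B <-]|A _].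
- by exists set0.
- by case: (leP (diff e A) (diff e B)) => _; [exists B | exists A].
- by exists A.
Qed.

(** By supermodularity the differences of union and intersection sum to at least twice the maximum,
    so both attain it. *)
Lemma criticalI A B : critical e A -> critical e B -> critical e (A :&: B).
Proof.
move=> /eqP critA /eqP critB; apply/eqP.
have := diff_supermodular A B; have := diff_le_crit_diff (A :|: B).
have := diff_le_crit_diff (A :&: B); lia.
Qed.

Lemma critical_ker : critical e (ker e).
Proof.
have [A critA] := exists_critical.
(* The empty intersection is [setT], which may fail to be critical; intersecting throughout with a
   fixed critical [A] gives the induction a valid base case. *)
have /setIidPr <- : ker e \subset A by exact: (bigcap_inf A critA).
rewrite /ker; elim/big_ind: _ => [|B C critB critC|B]; first by rewrite setIT.
- by rewrite setIIr criticalI.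
- exact: criticalI.
Qed.

Hypothesis e_sym : symmetric e.

Lemma edge_adj x y : x != y -> [set x; y] \in edges e -> e x y.
Proof.
move=> neq_xy; rewrite inE => /existsP[p /existsP[q /andP[epq /eqP defE]]].
have := set21 x y; have := set22 x y; rewrite defE !in_set2.
by move=> /orP[] /eqP defy /orP[] /eqP defx; move: neq_xy;
  by rewrite defx defy ?eqxx // e_sym.
Qed.

Lemma matching_card_nbhdD X K M :
  independent e X -> matching_from_into e (nbhd e X) X M ->
  #|nbhd e X :\: nbhd e K| <= #|X :\: K|.
Proof.
move=> /forall_inP indX /and3P[/andP[/subsetP edgeM trivM]].
move=> /forall_inP matchM /subsetP covM.
have NX_notin y : y \in nbhd e X -> y \notin X.
  move=> /nbhdP[x xX exy]; apply: contraL exy => yX.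
  exact: (forall_inP (indX x xX)).
have neqNX x y : y \in nbhd e X -> x \in X -> y != x.
  by move=> /NX_notin yX xX; apply: contraNneq yX => ->.
(* The default [y] is never reached on [nbhd e X], by [partnerP]. *)
pose partner y := odflt y [pick x in X | [set y; x] \in M].
have partnerP y : y \in nbhd e X ->
    partner y \in X /\ [set y; partner y] \in M.
  move=> yN; rewrite /partner; case: pickP => [x /andP[]//|noX].
  have /bigcupP[E EM yE] := covM y yN.
  have /exists_inP[a aN /exists_inP[b bX /eqP defE]] := matchM E EM.
  (* Since [y] lies outside [X], it must be the end [a] of the edge covering it. *)
  move: yE; rewrite defE in_set2 (negPf (neqNX _ _ yN bX)) orbF => /eqP defy.
  by have := noX b; rewrite bX defy -defE EM.
have inj_partner : {in nbhd e X :\: nbhd e K &, injective partner}.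
  move=> y z /setDP[yN _] /setDP[zN _] eq_yz.
  have [[pyX yM] [_ zM]] := (partnerP y yN, partnerP z zN).
  (* Two edges of a matching with a common end coincide. *)
  have eqE : [set y; partner y] = [set z; partner y].
    apply/eqP/negPn/negP => neqE.
    have := trivIsetP trivM _ _ yM; rewrite eq_yz => /(_ _ zM).
    rewrite -eq_yz => /(_ neqE) /disjointFr /(_ (set22 _ _)).
    by rewrite set22.
  have := set21 y (partner y); rewrite eqE in_set2.
  by rewrite (negPf (neqNX _ _ yN pyX)) orbF => /eqP.
rewrite -(card_in_imset inj_partner) subset_leq_card //.
apply/subsetP => _ /imsetP[y /setDP[yN yNK] ->].
have [pyX yM] := partnerP y yN.
rewrite in_setD pyX andbT; apply: contra yNK => pyK.
apply/nbhdP; exists (partner y) => //.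
by rewrite e_sym edge_adj ?edgeM // neqNX.
Qed.

End CriticalSets.

Theorem theorem2p15 (T : finType) (e : rel T)
    (e_sym : symmetric e) (e_irr : irreflexive e)
    (X : {set T}) (X_indep : independent e X)
    (kerX : ker e \subset X)
    (X_match : exists M : {set {set T}}, matching_from_into e (nbhd e X) X M) :
  critical e X.
Proof.
have [M matchM] := X_match.
have := matching_card_nbhdD e_sym (ker e) X_indep matchM.
rewrite !cardsDS ?nbhdS // => cardD.
(* These two bounds make the truncated subtractions in [cardD] exact, so that it yields
   [diff e (ker e) <= diff e X]. *)
have cardK := subset_leq_card kerX.
have cardNK := subset_leq_card (nbhdS e kerX).
have /eqP critK := critical_ker e.
have := diff_le_crit_diff e X; rewrite /critical -critK /diff => leXK.
by apply/eqP; lia.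
Qed.
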